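(* Let $\mathfrak g_1$ be a Lie algebra of finite dimension $n$ with underlying vector space $V=\mathbb R^n$, let $u$ be a diagonal $n\times n$ matrix independent of $\varepsilon$, and let $\mathfrak g_1=V_N\oplus V_R$ be the splitting determined by $uV_N=0$ and $uV=V_R$. Let $$T[u](\xi,\eta)=u^2[\xi,\eta]-u\big([u\xi,\eta]+[\xi,u\eta]\big)+[u\xi,u\eta].$$ Then: (1) if $T[u](\xi,\eta)\in V_R$ for all $\xi,\eta\in\mathfrak g_1$, then $U_{IW}=\varepsilon\,\mathrm{Id}+(1-\varepsilon)u$ defines a valid Lie algebra contraction (an Inönü–Wigner contraction); (2) if $T[u](\xi,\eta)\in V_N$ for all $\xi,\eta\in\mathfrak g_1$, then $U_{anti\text{-}IW}=\varepsilon^2\,\mathrm{Id}+\varepsilon(1-\varepsilon)u$ defines a valid Lie algebra contraction (an anti-Inönü–Wigner contraction).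
   Context: A family of linear maps $U=U_\varepsilon$ on the vector space of $\mathfrak g_1$, invertible for small $\varepsilon>0$, defines a valid Lie algebra contraction of $\mathfrak g_1$ if for all $\xi,\eta$ the limit $[\xi,\eta]_0:=\lim_{\varepsilon\to0}U_\varepsilon^{-1}[U_\varepsilon\xi,U_\varepsilon\eta]$ exists; $[\cdot,\cdot]_0$ is then the bracket of the contracted Lie algebra. Contractions given by a matrix of the form $\varepsilon\,\mathrm{Id}+(1-\varepsilon)u$ are called Inönü–Wigner (IW) contractions, and those given by a matrix of the form $\varepsilon^2\,\mathrm{Id}+\varepsilon(1-\varepsilon)u$ are called anti-Inönü–Wigner contractions. Since $u$ is diagonal, $V_N=\ker u$ and $V_R=\operatorname{im}u$ are complementary. The map $T[u]$ is called the IW-tensor. *)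

(* Defs.v *)
From HB Require Import structures.
From mathcomp Require Import all_boot all_order all_algebra.
From mathcomp Require Import all_classical all_reals all_analysis.
Import Order.TTheory GRing.Theory Num.Theory numFieldNormedType.Exports.

Set Implicit Arguments.
Unset Strict Implicit.
Unset Printing Implicit Defensive.

Local Open Scope classical_set_scope.
Local Open Scope ring_scope.

Section LieAlgebraContractions.
Variables (R : realType) (n : nat).
Local Notation V := 'cV[R]_n.
Implicit Types (br : V -> V -> V) (u : 'M[R]_n) (U : R -> 'M[R]_n).

Definition lie_bracket br : Prop :=
  [/\ bilinear_for *:%R *:%R br,
      forall xi, br xi xi = 0
    & forall xi eta zeta,
        br xi (br eta zeta) + br eta (br zeta xi) + br zeta (br xi eta) = 0].

(* Only meaningful for those e at which U e is invertible: invmx is the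
   identity function on singular matrices. *)
Definition deformed_bracket br U (e : R) : V -> V -> V :=
  fun xi eta => invmx (U e) *m br (U e *m xi) (U e *m eta).

Definition contracted_bracket br U : V -> V -> V :=
  fun xi eta => lim (deformed_bracket br U e xi eta @[e --> 0^'+]).

Definition valid_contraction br U : Prop :=
  (\forall e \near 0^'+, U e \in unitmx) /\
  (forall xi eta, cvg (deformed_bracket br U e xi eta @[e --> 0^'+])).

Definition U_IW u (e : R) : 'M[R]_n := e%:M + (1 - e) *: u.

Definition U_antiIW u (e : R) : 'M[R]_n := (e ^+ 2)%:M + (e * (1 - e)) *: u.

Definition V_N u : set V := [set xi | u *m xi = 0].

Definition V_R u : set V := range (fun xi : V => u *m xi).

Definition IW_tensor br u (xi eta : V) : V :=
  u *m (u *m br xi eta) - u *m (br (u *m xi) eta + br xi (u *m eta))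
  + br (u *m xi) (u *m eta).

(* Complementarity of V_N and V_R holds because u is diagonal. *)
Lemma V_N_V_R_direct u : is_diag_mx u ->
  forall xi, exists! p : V * V, [/\ V_N u p.1, V_R u p.2 & xi = p.1 + p.2].
Proof.
case/diag_mxP => d -> xi.
pose N : V := \col_i (if d 0 i == 0 then xi i 0 else 0).
pose Q : V := \col_i (if d 0 i == 0 then 0 else xi i 0).
have NR (x y : V) : V_N (diag_mx d) x -> V_R (diag_mx d) y ->
    forall i, (d 0 i == 0 -> y i 0 = 0) /\ (d 0 i != 0 -> x i 0 = 0).
  move=> xN [z _ <-] i; split=> [/eqP d0|d0].
    by rewrite mul_diag_mx !mxE d0 mul0r.
  move/matrixP/(_ i 0): xN; rewrite mul_diag_mx !mxE => /eqP.
  by rewrite mulf_eq0 (negPf d0) => /eqP.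
exists (N, Q); split.
  split=> /=.
  - apply/matrixP => i j; rewrite mul_diag_mx !mxE.
    by case: eqP => [->|]; rewrite ?mul0r ?mulr0.
  - exists (\col_i ((d 0 i)^-1 * xi i 0)) => //.
    apply/matrixP => i j; rewrite mul_diag_mx !mxE.
    by case: eqP => [->|/eqP d0]; rewrite ?mul0r // mulVKf.
  - by apply/matrixP => i j; rewrite !mxE ord1; case: ifP; rewrite ?addr0 ?add0r.
move=> [x y] [/= xN yR xiE].
have H i := NR _ _ xN yR i.
by congr pair; apply/matrixP => i j; rewrite !mxE xiE !mxE ord1;
  have [H0 H1] := H i; case: ifPn => d0;
  rewrite ?(H0 d0) ?(H1 d0) ?addr0 ?add0r.
Qed.

(* The limit bracket of a valid contraction is again a Lie bracket, which is
   why valid_contraction does not demand it. *)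
Lemma contracted_bracket_lie br U :
  lie_bracket br -> valid_contraction br U ->
  lie_bracket (contracted_bracket br U).
Proof.
move=> [[brl brr] br0 brJ] [Uu Ucvg].
pose b e := deformed_bracket br U e.
have b_cvg xi eta : b e xi eta @[e --> 0^'+] --> contracted_bracket br U xi eta.
  exact: Ucvg.
have bl e c x y z : b e (c *: x + y) z = c *: b e x z + b e y z.
  by rewrite /b /deformed_bracket linearP (brl _ c) linearP.
have br' e c x y z : b e z (c *: x + y) = c *: b e z x + b e z y.
  by rewrite /b /deformed_bracket linearP (brr _ c) linearP.
have hausV := @norm_hausdorff R V.
have b_sum e (x w : V) : b e x w = \sum_i w i 0 *: b e x (delta_mx i 0).
  have b0 z : b e z 0 = 0.
    by have := br' e (-1) z z z; rewrite scaleN1r addNr scaleN1r addNr.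
  have {1}-> : w = \sum_i w i 0 *: delta_mx i 0.
    rewrite {1}(matrix_sum_delta w); apply: eq_bigr => i _.
    by rewrite big_ord1.
  elim/big_rec2 : _ => [|i t s _ <-]; first exact: b0.
  by rewrite br'.
have b_cvg2 (x y z : V) : b e x (b e y z) @[e --> 0^'+] -->
    contracted_bracket br U x (contracted_bracket br U y z).
  set w := contracted_bracket br U y z.
  have -> : contracted_bracket br U x w =
      \sum_i w i 0 *: contracted_bracket br U x (delta_mx i 0).
    apply: (cvg_unique _ (b_cvg x w)) => //.
    rewrite (_ : (fun e => _) = fun e => \sum_i w i 0 *: b e x (delta_mx i 0)).
      by apply: (cvg_big add_continuous) => i _; apply: cvgZ => //; exact: cvg_cst.
    by apply/funext => e; exact: b_sum.
  rewrite (_ : (fun e => _) =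
    fun e => \sum_i (b e y z) i 0 *: b e x (delta_mx i 0)); last first.
    by apply/funext => e; exact: b_sum.
  apply: (cvg_big add_continuous) => i _; apply: cvgZ; last exact: b_cvg.
  apply: (@cvg_comp _ _ _ (fun e => b e y z) (fun M : V => M i 0) _ _ _
    (b_cvg y z)).
  exact: coord_continuous.
split.
- split=> [z c x y|z c x y] /=.
  + apply: (cvg_unique _ (b_cvg _ _)) => //.
    rewrite (_ : (fun e => _) = fun e => c *: b e x z + b e y z).
      by apply: cvgD => //; apply: cvgZ => //; exact: cvg_cst.
    by apply/funext => e; exact: bl.
  + apply: (cvg_unique _ (b_cvg _ _)) => //.
    rewrite (_ : (fun e => _) = fun e => c *: b e z x + b e z y).
      by apply: cvgD => //; apply: cvgZ => //; exact: cvg_cst.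
    by apply/funext => e; exact: br'.
- move=> x; apply: (cvg_unique _ (b_cvg _ _)) => //.
  rewrite (_ : (fun e => _) = fun=> 0); first exact: cvg_cst.
  by apply/funext => e; rewrite /b /deformed_bracket br0 mulmx0.
- move=> x y z.
  pose J e := b e x (b e y z) + b e y (b e z x) + b e z (b e x y).
  have Jcvg : J @ 0^'+ --> _ :=
    cvgD (cvgD (b_cvg2 x y z) (b_cvg2 y z x)) (b_cvg2 z x y).
  apply: (cvg_unique hausV (Jcvg _ _)).
  apply: cvg_near_cst.
  apply: filterS Uu => e Ue.
  by rewrite /J /b /deformed_bracket !mulKVmx // -!mulmxDr brJ mulmx0.
Qed.

End LieAlgebraContractions.

(* Main.v *)
(** Since [u = diag d], convergence can be tested coordinatewise. [U_IW] scales
    coordinate [i] by [e + (1 - e) d_i], which tends to [d_i], so dividing by it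
    is harmless unless [d_i = 0], where it divides by [e]. In that case the
    [e]-free part of the bracket is [[u xi, u eta]_i], the [i]-th coordinate of
    the IW-tensor, which vanishes when the tensor lies in [V_R]. For the other
    family, [U_antiIW = e U_IW] multiplies the deformed bracket by an extra
    factor [e], which compensates the division by [e]. *)
Require Import Defs.
From mathcomp Require Import all_boot all_order all_algebra.
From mathcomp Require Import all_classical all_reals all_analysis.
From mathcomp Require Import ring.
Import Order.TTheory GRing.Theory Num.Theory numFieldNormedType.Exports.

Set Implicit Arguments.
Unset Strict Implicit.
Unset Printing Implicit Defensive.

Local Open Scope classical_set_scope.
Local Open Scope ring_scope.

(** A column is a finite sum of its coordinates times basis vectors, and scalings and finite sums
    preserve convergence. *)
Lemma is_cvg_coord (R : realType) (n : nat) (T : Type) (F : set_system T)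
    {FF : Filter F} (f : T -> 'cV[R]_n) :
  (forall i, cvg (f x i 0 @[x --> F])) -> cvg (f x @[x --> F]).
Proof.
move=> fcvg.
pose l : 'cV[R]_n := \sum_i lim (f x i 0 @[x --> F]) *: delta_mx i 0.
apply/cvg_ex; exists l.
rewrite (_ : (fun x => f x) = fun x => \sum_i f x i 0 *: delta_mx i 0).
  apply: (cvg_big add_continuous) => i _.
  by apply: cvgZ; [exact: fcvg | exact: cvg_cst].
apply/funext => x; rewrite {1}(matrix_sum_delta (f x)).
by apply: eq_bigr => i _; rewrite big_ord1.
Qed.

Lemma is_cvg_near_eq (T : Type) (U : ptopologicalType) (F : set_system T)
    {FF : Filter F} (f g : T -> U) :
  (\forall x \near F, f x = g x) -> cvg (g @ F) -> cvg (f @ F).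
Proof.
move=> fg /cvg_ex[l gl]; apply/cvg_ex; exists l; apply: cvg_trans gl.
by apply: near_eq_cvg; apply: filterS fg => x ->.
Qed.

Lemma cvg_horner_at_right0 (R : realType) (p : {poly R}) :
  p.[e] @[e --> 0^'+] --> p.[0].
Proof. by apply: cvg_at_right_filter; exact: continuous_horner. Qed.

Lemma is_cvg_horner_at_right0 (R : realType) (p : {poly R}) :
  cvg (p.[e] @[e --> 0^'+]).
Proof. by apply/cvg_ex; eexists; exact: cvg_horner_at_right0. Qed.

Lemma invmx_diag_mul_coord (F : fieldType) (n : nat) (a : 'rV[F]_n)
    (w : 'cV[F]_n) (i : 'I_n) :
  diag_mx a \in unitmx -> (invmx (diag_mx a) *m w) i 0 = (a 0 i)^-1 * w i 0.
Proof.
move=> aU; have := aU; rewrite unitmxE det_diag unitfE.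
move=> /prodf_neq0/(_ i isT) ai0.
(* Writing [w] as [diag_mx a] times its preimage avoids computing the inverse matrix. *)
by rewrite -[in RHS](mulKVmx aU w) mul_diag_mx [in RHS]mxE mulKf.
Qed.

Lemma U_IW_diag (R : realType) (n : nat) (d : 'rV[R]_n) (e : R) :
  U_IW (diag_mx d) e = diag_mx (\row_i (e + (1 - e) * d 0 i)).
Proof.
apply/matrixP => i j; rewrite !mxE.
case: eqP => [->|_]; first by rewrite !mulr1n.
by rewrite !mulr0n mulr0 addr0.
Qed.

Lemma U_antiIW_scale (R : realType) (n : nat) (u : 'M[R]_n) (e : R) :
  U_antiIW u e = e *: U_IW u e.
Proof. by rewrite /U_antiIW /U_IW scalerDr scale_scalar_mx scalerA expr2. Qed.

(** The determinant is the product of the factors [e + (1 - e) * d 0 i]. Each is either [e] itself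
    or tends to [d 0 i != 0], and there are finitely many. *)
Lemma U_IW_unit_near (R : realType) (n : nat) (d : 'rV[R]_n) :
  \forall e \near 0^'+, U_IW (diag_mx d) e \in unitmx.
Proof.
have : \forall e \near (0 : R)^'+, forall i, e + (1 - e) * d 0 i != 0.
  apply: filter_forall => i.
  have [di0|di0] := eqVneq (d 0 i) 0.
    by apply: filterS (nbhs_right_neq 0) => e; rewrite di0 mulr0 addr0.
  pose p : {poly R} := 'X + (1 - 'X) * (d 0 i)%:P.
  have pE e : p.[e] = e + (1 - e) * d 0 i by rewrite /p !hornerE.
  have p0 : p.[0] != 0 by rewrite pE add0r subr0 mul1r.
  have := @cvg_horner_at_right0 R p.
  move=> /cvgr_neq0/(_ p0); by apply: filterS => e; rewrite pE.
apply: filterS => e ne0; rewrite U_IW_diag unitmxE det_diag unitfE.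
by apply/prodf_neq0 => i _; rewrite mxE.
Qed.

Section BracketExpansion.
Variables (R : realType) (n : nat) (br : 'cV[R]_n -> 'cV[R]_n -> 'cV[R]_n).
Hypothesis hbr : lie_bracket br.

Lemma lie_bracketZD (a b : R) (x y z t : 'cV[R]_n) :
  br (a *: x + b *: y) (a *: z + b *: t) =
  a ^+ 2 *: br x z + (a * b) *: (br y z + br x t) + b ^+ 2 *: br y t.
Proof.
have [[brl brr] _ _] := hbr.
have br0l w : br 0 w = 0.
  (* At scalar [-1] and zero vectors, linearity reads [br 0 w = - br 0 w + br 0 w]. *)
  by have := brl w (-1) 0 0; rewrite /= scaleN1r addNr scaleN1r addNr.
have br0r w : br w 0 = 0.
  by have := brr w (-1) 0 0; rewrite /= scaleN1r addNr scaleN1r addNr.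
have brlZ c v w : br (c *: v) w = c *: br v w.
  by have := brl w c v 0; rewrite /= br0l !addr0.
have brrZ c v w : br w (c *: v) = c *: br w v.
  by have := brr w c v 0; rewrite /= br0r !addr0.
rewrite brl brlZ !brr !brrZ.
apply/matrixP => i j; rewrite !mxE; ring.
Qed.

(** A polynomial in [e] is continuous at [0], and is divisible by [e] as soon as its value at [0]
    vanishes. *)
Lemma U_IW_bracket_coord (u : 'M[R]_n) (xi eta : 'cV[R]_n) (i : 'I_n) :
  exists2 p : {poly R}, p.[0] = br (u *m xi) (u *m eta) i 0
    & forall e, br (U_IW u e *m xi) (U_IW u e *m eta) i 0 = p.[e].
Proof.
exists ('X ^+ 2 * (br xi eta i 0)%:P
  + 'X * (1 - 'X) * (br (u *m xi) eta i 0 + br xi (u *m eta) i 0)%:P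
  + (1 - 'X) ^+ 2 * (br (u *m xi) (u *m eta) i 0)%:P).
  by rewrite !hornerE /=; ring.
move=> e; rewrite /U_IW !mulmxDl !mul_scalar_mx -!scalemxAl lie_bracketZD.
by rewrite !mxE !hornerE /=; ring.
Qed.

Lemma deformed_bracket_IW_coord (d : 'rV[R]_n) (xi eta : 'cV[R]_n) (i : 'I_n) :
  exists2 p : {poly R}, p.[0] = br (diag_mx d *m xi) (diag_mx d *m eta) i 0
    & \forall e \near 0^'+, deformed_bracket br (U_IW (diag_mx d)) e xi eta i 0
        = (e + (1 - e) * d 0 i)^-1 * p.[e].
Proof.
have [p p0 pE] := U_IW_bracket_coord (diag_mx d) xi eta i; exists p => //.
apply: filterS (U_IW_unit_near d) => e Ue.
rewrite /deformed_bracket -pE [in invmx _]U_IW_diag invmx_diag_mul_coord ?mxE //.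
by rewrite -U_IW_diag.
Qed.

(** Bilinearity produces [e ^+ 2], of which the inverse of [e *: U_IW u e] cancels one factor. *)
Lemma deformed_bracket_antiIW (u : 'M[R]_n) (e : R) (xi eta : 'cV[R]_n) :
  e != 0 -> U_IW u e \in unitmx ->
  deformed_bracket br (U_antiIW u) e xi eta
    = e *: deformed_bracket br (U_IW u) e xi eta.
Proof.
move=> e0 Ue; rewrite /deformed_bracket U_antiIW_scale -!scalemxAl.
have := lie_bracketZD e 0 (U_IW u e *m xi) 0 (U_IW u e *m eta) 0.
rewrite !scale0r !addr0 mulr0 expr0n /= !scale0r !addr0 => ->.
rewrite invmxZ ?unitmxZ ?unitfE // -scalemxAl -scalemxAr scalerA expr2.
by rewrite mulKf.
Qed.

Lemma is_cvg_deformed_bracket_IW_coord (d : 'rV[R]_n) (xi eta : 'cV[R]_n)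
    (i : 'I_n) : d 0 i != 0 ->
  cvg (deformed_bracket br (U_IW (diag_mx d)) e xi eta i 0 @[e --> 0^'+]).
Proof.
move=> di0; have [p _ pE] := deformed_bracket_IW_coord d xi eta i.
apply: (is_cvg_near_eq pE).
pose q : {poly R} := 'X + (1 - 'X) * (d 0 i)%:P.
have qE e : q.[e] = e + (1 - e) * d 0 i by rewrite /q !hornerE.
under eq_fun do rewrite -qE.
apply: is_cvgM; last exact: is_cvg_horner_at_right0.
apply/cvg_ex; eexists; apply: cvgV; last exact: cvg_horner_at_right0.
by rewrite qE add0r subr0 mul1r.
Qed.

End BracketExpansion.

Theorem theorem4p3 (R : realType) (n : nat)
    (br : 'cV[R]_n -> 'cV[R]_n -> 'cV[R]_n) (u : 'M[R]_n)
    (hbr : lie_bracket br) (hu : is_diag_mx u) :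
  ((forall xi eta : 'cV[R]_n, V_R u (IW_tensor br u xi eta)) ->
     valid_contraction br (U_IW u)) /\
  ((forall xi eta : 'cV[R]_n, V_N u (IW_tensor br u xi eta)) ->
     valid_contraction br (U_antiIW u)).
Proof.
have /diag_mxP[d ->] := hu.
have e_neq0 : \forall e \near (0 : R)^'+, e != 0 by exact: nbhs_right_neq.
split=> [TR|_]; split.
- exact: U_IW_unit_near.
- move=> xi eta; apply: is_cvg_coord => i.
  have [di0|di0] := eqVneq (d 0 i) 0; last first.
    exact: is_cvg_deformed_bracket_IW_coord.
  have [p p0 pE] := deformed_bracket_IW_coord hbr d xi eta i.
  (* Row [i] of [diag_mx d] is zero, so coordinate [i] vanishes on [V_R] and on the tensor terms
     with a leading [u]. What remains is [p.[0] = 0]. *)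
  have /factor_theorem[q pq] : root p 0.
    have [z _] := TR xi eta; rewrite /IW_tensor rootE p0.
    move=> /matrixP/(_ i 0).
    by rewrite !mul_diag_mx !mxE di0 !mul0r subr0 add0r => <-.
  suff qE : \forall e \near 0^'+,
      deformed_bracket br (U_IW (diag_mx d)) e xi eta i 0 = q.[e].
    by apply: (is_cvg_near_eq qE); exact: is_cvg_horner_at_right0.
  apply: filterS2 pE e_neq0 => e -> e0.
  by rewrite pq di0 mulr0 addr0 hornerM hornerXsubC subr0 mulrC mulfK.
- apply: filterS2 (U_IW_unit_near d) e_neq0 => e Ue e0.
  by rewrite U_antiIW_scale unitmxZ ?unitfE.
- move=> xi eta; apply: is_cvg_coord => i.
  have antiE : \forall e \near 0^'+,
      deformed_bracket br (U_antiIW (diag_mx d)) e xi eta i 0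
      = e * deformed_bracket br (U_IW (diag_mx d)) e xi eta i 0.
    apply: filterS2 (U_IW_unit_near d) e_neq0 => e Ue e0.
    by rewrite deformed_bracket_antiIW // mxE.
  apply: (is_cvg_near_eq antiE).
  (* If [d 0 i = 0], the extra [e] cancels the division by [e] and leaves [p.[e]]. Otherwise the
     coordinate is [e] times a convergent function. *)
  have [di0|di0] := eqVneq (d 0 i) 0.
    have [p _ pE] := deformed_bracket_IW_coord hbr d xi eta i.
    suff epE : \forall e \near 0^'+,
        e * deformed_bracket br (U_IW (diag_mx d)) e xi eta i 0 = p.[e].
      by apply: (is_cvg_near_eq epE); exact: is_cvg_horner_at_right0.
    apply: filterS2 pE e_neq0 => e -> e0.
    by rewrite di0 mulr0 addr0 mulVKf.
  apply: is_cvgM; last exact: is_cvg_deformed_bracket_IW_coord.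
  by apply/cvg_ex; exists 0; apply: cvg_at_right_filter; exact: cvg_id.
Qed.
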